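(* Let $n\ge1$ and let $\mathbf{X}=(X_0,\dots,X_{n-1})$ be a random vector with values in $\{-1,1\}^n$. Put $p_k=\Pr(X_k=1)$ for $k=0,\dots,n-1$. For a vector of betting fractions $\mathbf{K}=[\tilde K_0,\tilde K_1,\dots,\tilde K_{n-1}]^T\in[-1,1]^n$ decided prior to the start of the game, the expected logarithmic growth is $$\mathrm{ELG}(\mathbf{K})=\frac1n\sum_{k=0}^{n-1}\left\{p_k\log(1+\tilde K_k)+(1-p_k)\log(1-\tilde K_k)\right\},$$ and this is maximized at $$\tilde K_k=2p_k-1,\qquad k=0,\dots,n-1.$$ Moreover, with these maximizing values $\tilde K_k$, the optimal time-invariant betting fraction $K_n=2\left\{\frac{\mathbb{E}(H_n(\mathbf{X}))}{n}\right\}-1$ satisfies $$K_n=\frac1n\sum_{k=0}^{n-1}\tilde K_k.$$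
   Context: Even-money coin-flipping game: $X_k=1$ is a head and $X_k=-1$ a tail on flip $k$. With initial account value $V_0>0$ and a bet $\tilde K_kV_k$ on flip $k$ (negative values meaning a bet on tails), the account value evolves as $V_{k+1}=(1+\tilde K_kX_k)V_k$. The expected logarithmic growth is $$\mathrm{ELG}(\mathbf{K})=\frac1n\,\mathbb{E}\left\{\log\left[\frac{V_n}{V_0}\right]\right\}.$$ Conventions: $\log 0=-\infty$ and $0\cdot\log 0=0$. $H_n(\mathbf{X})$ denotes the number of indices $k\in\{0,\dots,n-1\}$ with $X_k=1$. The number $K_n$ is the constant betting fraction $K\in[-1,1]$ maximizing $\mathrm{ELG}$ among the constant vectors $\mathbf{K}=[K,\dots,K]^T$. *)

(* Defs.v *)
From HB Require Import structures.
From mathcomp Require Import all_boot all_order all_algebra.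
From mathcomp Require Import all_classical all_reals all_analysis.

Set Implicit Arguments.
Unset Strict Implicit.
Unset Printing Implicit Defensive.

Import Order.TTheory GRing.Theory Num.Theory.
Import numFieldNormedType.Exports.

Local Open Scope classical_set_scope.
Local Open Scope ring_scope.

(* V_{k+1} = (1 + K_k x_k) V_k for k < n.  Flips are indexed by 'I_n while the
   recursion runs over nat; the None branch (k >= n) is never reached in V_n. *)
Fixpoint account (R : realType) (n : nat) (V0 : R) (K : 'cV[R]_n)
    (x : 'I_n -> R) (k : nat) : R :=
  match k with
  | 0%N => V0
  | j.+1 =>
      match (insub j : option 'I_n) with
      | Some i => (1 + K i 0 * x i) * account V0 K x j
      | None => account V0 K x j
      end
  end.

(* [lne] is the extended logarithm, with log 0 = -oo; the library's expectation
   only takes real-valued functions, hence the explicit integral. *)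
Definition ELG (d : measure_display) (T : measurableType d) (R : realType)
    (P : probability T R) (n : nat) (X : 'I_n -> {RV P >-> R})
    (V0 : R) (K : 'cV[R]_n) : \bar R :=
  ((n%:R^-1)%:E *
    \int[P]_w lne (account V0 K (fun i => X i w) n / V0)%:E)%E.

Definition prob_head (d : measure_display) (T : measurableType d)
    (R : realType) (P : probability T R) (n : nat)
    (X : 'I_n -> {RV P >-> R}) (k : 'I_n) : R :=
  fine (P [set w | X k w = 1]).

Definition num_heads (d : measure_display) (T : measurableType d)
    (R : realType) (P : probability T R) (n : nat)
    (X : 'I_n -> {RV P >-> R}) (w : T) : R :=
  #|[pred k : 'I_n | X k w == 1]|%:R.

Definition bet_vectors (R : realType) (n : nat) : set 'cV[R]_n :=
  [set K | forall k, -1 <= K k 0 <= 1].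
Arguments bet_vectors : clear implicits.

Definition is_maximizer (A : Type) (R : realType) (D : set A)
    (f : A -> \bar R) (a : A) : Prop :=
  D a /\ forall b, D b -> (f b <= f a)%E.

(* Main.v *)
Require Import Defs.
From HB Require Import structures.
From mathcomp Require Import all_boot all_order all_algebra.
From mathcomp Require Import all_classical all_reals all_analysis.
From mathcomp Require Import measurable_realfun ring lra.
Import Order.TTheory GRing.Theory Num.Theory.
Import numFieldNormedType.Exports.
Local Open Scope classical_set_scope.
Local Open Scope ring_scope.

(** The logarithm of the final wealth ratio is the sum over the flips of
    log (1 + K_k X_k), and the k-th summand takes the value log (1 + K_k) with
    probability p_k and log (1 - K_k) with probability 1 - p_k.  Only the
    marginal law of each flip enters, and linearity of the expectation turns the
    expected log growth into the average of the one-flip growths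
    [growth p_k K_k] ([ELG_growth]).

    All-in bets make some summands equal to -oo, possibly with positive
    probability, so the summands need not be integrable.  They are bounded
    above by 2, however, and the integral is still additive on functions
    bounded above ([integralD_ubounded]), because the integrals of the positive
    parts stay finite.

    The variables K_k are now decoupled.  Each one-flip growth has
    c = 2 p - 1 as its unique maximizer on [-1, 1] ([growth_lt_opt]); this is
    Gibbs' inequality, obtained by adding the tangent bounds for the concave
    logarithm at 2 p and at 2 (1 - p), whose linear parts cancel.  The maximal
    value is finite, so one strict inequality among the summands makes the sum
    strictly smaller, and the maximizing vector is unique.

    The growth is affine in p, so with the constant fraction c the average of
    the growths is [growth q c], where q is the average of the p_k
    ([sum_growth_average]).  The same one-flip fact gives the unique best
    constant 2 q - 1, which is the average of the 2 p_k - 1, and q is the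
    expected proportion of heads. *)

(** * Integrals of functions bounded above *)

(** Both sides are obtained by moving the negative parts across
    (x + y)^+ - (x + y)^- = (x^+ - x^-) + (y^+ - y^-), which leaves only sums of
    nonnegative quantities. *)
Lemma maxe_pos_neg {R : realType} (x y : \bar R) : (x < +oo)%E -> (y < +oo)%E ->
  (maxe (x + y) 0 + (maxe (- x) 0 + maxe (- y) 0) =
   maxe (- (x + y)) 0 + (maxe x 0 + maxe y 0))%E.
Proof.
have max_pos_neg (r : R) : Num.max r 0 - Num.max (- r) 0 = r.
  by case: (leP r 0) => ?; case: (leP (- r) 0) => ?; lra.
case: x y => [r| |] [s| |]// _ _.
- rewrite -!EFinD -!EFinN -!EFin_max -!EFinD; congr _%:E.
  have := max_pos_neg r; have := max_pos_neg s; have := max_pos_neg (r + s).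
  lra.
- by rewrite -EFinN -!EFin_max addeNy /= maxNye !maxye addey// addye.
- by rewrite -EFinN -!EFin_max addNye /= maxNye !maxye addye// addye.
- by rewrite /= maxNye !maxye.
Qed.

Lemma integral_funepos_lty {d : measure_display} {T : measurableType d}
    {R : realType} (P : probability T R) {f : T -> \bar R} {c : R} :
  measurable_fun [set: T] f -> (forall x, (f x <= c%:E)%E) ->
  (\int[P]_x f^\+ x < +oo)%E.
Proof.
move=> mf fc; apply: (@le_lt_trans _ _ (\int[P]_x cst (`|c|%:E) x)%E).
  apply: ge0_le_integral => //.
  - exact: measurable_funepos.
  - move=> x _; rewrite funeposE ge_max lee_fin normr_ge0 andbT.
    by rewrite (le_trans (fc x))// lee_fin ler_norm.
by rewrite integral_cst//= probability_setT mule1 ltry.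
Qed.

(** Integrability of f and g is replaced by an upper bound: the integrals of f
    and g may be -oo, but those of the positive parts are finite, so the
    identity between nonnegative integrals given by [maxe_pos_neg] can be solved
    for the integral of f + g. *)
Lemma integralD_ubounded {d : measure_display} {T : measurableType d}
    {R : realType} (P : probability T R) {f g : T -> \bar R} {c e : R} :
  measurable_fun [set: T] f -> measurable_fun [set: T] g ->
  (forall x, (f x <= c%:E)%E) -> (forall x, (g x <= e%:E)%E) ->
  (\int[P]_x (f x + g x) = \int[P]_x f x + \int[P]_x g x)%E.
Proof.
move=> mf mg fc ge.
have mfg : measurable_fun [set: T] (f \+ g)%E by exact: emeasurable_funD.
have fgce x : ((f \+ g)%E x <= (c + e)%:E)%E by rewrite EFinD leeD.
have foo := integral_funepos_lty P mf fc.
have goo := integral_funepos_lty P mg ge.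
have fgoo := integral_funepos_lty P mfg fgce.
have parts x : ((f \+ g)^\+ x + (f^\- x + g^\- x) =
                (f \+ g)^\- x + (f^\+ x + g^\+ x))%E.
  rewrite !funeposE !funenegE; apply: maxe_pos_neg.
    exact: le_lt_trans (fc x) (ltry _).
  exact: le_lt_trans (ge x) (ltry _).
have mp (h : T -> \bar R) : measurable_fun [set: T] h ->
    measurable_fun [set: T] h^\+%E by exact: measurable_funepos.
have mn (h : T -> \bar R) : measurable_fun [set: T] h ->
    measurable_fun [set: T] h^\-%E by exact: measurable_funeneg.
have splitD (u v w : T -> \bar R) : measurable_fun [set: T] u ->
    measurable_fun [set: T] v -> measurable_fun [set: T] w ->
    (forall x, 0 <= u x)%E -> (forall x, 0 <= v x)%E ->
    (forall x, 0 <= w x)%E ->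
    (\int[P]_x (u x + (v x + w x)) =
     \int[P]_x u x + (\int[P]_x v x + \int[P]_x w x))%E.
  move=> mu mv mw u0 v0 w0; rewrite ge0_integralD//; last 2 first.
  - by move=> x _; rewrite adde_ge0.
  - exact: emeasurable_funD.
  by rewrite ge0_integralD.
have : (\int[P]_x ((f \+ g)^\+ x + (f^\- x + g^\- x)) =
        \int[P]_x ((f \+ g)^\- x + (f^\+ x + g^\+ x)))%E.
  by apply: eq_integral => x _; exact: parts.
rewrite (splitD _ _ _ (mp _ mfg) (mn _ mf) (mn _ mg))//.
rewrite (splitD _ _ _ (mn _ mfg) (mp _ mf) (mp _ mg))//.
rewrite -[X in _ -> X = _]/(\int[P]_x (f \+ g)%E x)%E.
rewrite (integralE _ _ (f \+ g)%E) (integralE _ _ f) (integralE _ _ g).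
have ge0 (h : T -> \bar R) : (forall x, (0 <= h x)%E) -> (0 <= \int[P]_x h x)%E.
  by move=> h0; exact: integral_ge0.
move: fgoo foo goo (ge0 _ (funepos_ge0 (f \+ g)%E))
  (ge0 _ (funeneg_ge0 (f \+ g)%E)) (ge0 _ (funepos_ge0 f))
  (ge0 _ (funeneg_ge0 f)) (ge0 _ (funepos_ge0 g)) (ge0 _ (funeneg_ge0 g)).
move: (\int[P]_x (f \+ g)^\+ x)%E (\int[P]_x (f \+ g)^\- x)%E
  (\int[P]_x f^\+ x)%E (\int[P]_x f^\- x)%E
  (\int[P]_x g^\+ x)%E (\int[P]_x g^\- x)%E.
(* Infinite values are confined to the negative parts, where the identity
   forces the integral of (f + g)^- to be infinite exactly when that of f^- or
   of g^- is; the finite case is linear arithmetic. *)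
move=> [a| |] [b| |] [a1| |] // [b1| |] [a2| |] // [b2| |] //=.
move=> _ _ _ _ _ _ _ _ _ [key].
by congr EFin; lra.
Qed.

Lemma integral_sum_ubounded {d : measure_display} {T : measurableType d}
    {R : realType} (P : probability T R) {I : Type} (s : seq I)
    {f : I -> T -> \bar R} {c : R} :
  (forall i, measurable_fun [set: T] (f i)) ->
  (forall i x, (f i x <= c%:E)%E) ->
  (\int[P]_x (\sum_(i <- s) f i x) = \sum_(i <- s) \int[P]_x f i x)%E.
Proof.
move=> mf fc; elim: s => [|i s IH].
  rewrite big_nil; under eq_integral do rewrite big_nil.
  exact: integral0.
rewrite big_cons -IH; under eq_integral do rewrite big_cons.
apply: (integralD_ubounded P (c := c) (e := \sum_(j <- s) c)) => //.
  exact: emeasurable_sum.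
by move=> x; rewrite -sumEFin; apply: lee_sum.
Qed.

Lemma measurable_fun_two_valued {d : measure_display} {T : measurableType d}
    {R : realType} (A : set T) (a b : \bar R) :
  measurable A ->
  measurable_fun [set: T] (fun w => if w \in A then a else b).
Proof.
move=> mA; apply: measurable_fun_if => //.
apply: (measurable_fun_bool true); rewrite setTI.
rewrite [X in measurable X](_ : _ = A)//.
by apply/seteqP; split=> w; [exact: set_mem|exact: mem_set].
Qed.

(** The function is the sum of the constant a on A and the constant b off A.
    When a = -oo and A is negligible, the product on the right is 0 * -oo = 0,
    which is also the integral of -oo over A. *)
Lemma integral_two_valued {d : measure_display} {T : measurableType d}
    {R : realType} (P : probability T R) (A : set T) (a b : \bar R) :
  measurable A -> (a < +oo)%E -> (b < +oo)%E ->
  (\int[P]_w (if w \in A then a else b) = P A * a + (1 - P A) * b)%E.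
Proof.
move=> mA aoo boo.
have bound (x : \bar R) (B : set T) : (x < +oo)%E ->
    forall w, ((cst x \_ B) w <= `|fine x|%:E)%E.
  move=> xoo w; rewrite patchE; case: ifP => _; last by rewrite lee_fin.
  by move: x xoo => [r| |]//= _; rewrite ?leNye// lee_fin ler_norm.
have mcst (x : \bar R) (B : set T) : measurable B ->
    measurable_fun [set: T] (cst x \_ B).
  by move=> mB; apply: (proj1 (measurable_restrictT (cst x) mB)).
transitivity (\int[P]_w ((cst a \_ A) w + (cst b \_ (~` A)) w))%E.
  apply: eq_integral => w _; rewrite !patchE in_setC.
  by case: (w \in A); rewrite /= ?adde0 ?add0e.
rewrite (integralD_ubounded P (mcst _ _ mA) (mcst _ _ (measurableC mA))
  (bound _ _ aoo) (bound _ _ boo)).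
rewrite -!integral_mkcond !integral_cst//; last exact: measurableC.
rewrite muleC [X in (_ + X)%E]muleC; congr (_ + _ * _)%E.
exact: probability_setC.
Qed.

(** * The logarithm of the final account value *)

Lemma lne_lty {R : realType} (y : R) : (lne y%:E < +oo)%E.
Proof. by rewrite /=; case: ifP; rewrite ?ltNyr ?ltry. Qed.

Lemma lne_prod {R : realType} {I : Type} (s : seq I) (y : I -> R) :
  (forall i, 0 <= y i) ->
  (lne (\prod_(i <- s) y i)%:E = \sum_(i <- s) lne (y i)%:E)%E.
Proof.
move=> y0; elim: s => [|i s IH]; first by rewrite !big_nil lne1.
rewrite !big_cons -IH.
have := y0 i; rewrite le_eqVlt => /predU1P[<-|yi].
  by rewrite mul0r (le0_lneNy (x := 0)).
have : 0 <= \prod_(j <- s) y j by exact: prodr_ge0.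
rewrite le_eqVlt => /predU1P[<-|p0].
  by rewrite mulr0 (le0_lneNy (x := 0))// addeNy.
by rewrite EFinM lneM// in_itv/= lte_fin leey ?yi ?p0.
Qed.

(** The recursion for [account] skips indices outside 'I_n, hence the factor 1
    for them in the induction; none of these occurs below n. *)
Lemma account_prod {R : realType} (n : nat) (V0 : R) (K : 'cV[R]_n)
    (x : 'I_n -> R) :
  account V0 K x n = V0 * \prod_(k < n) (1 + K k 0 * x k).
Proof.
have prefix m : account V0 K x m = V0 * \prod_(j < m)
    (if (insub (j : nat) : option 'I_n) is Some i then 1 + K i 0 * x i else 1).
  elim: m => [|m IH] /=; first by rewrite big_ord0 mulr1.
  rewrite big_ord_recr /= IH; case: insub => [i|]; last by rewrite mulr1.
  by rewrite mulrCA; congr (_ * _); rewrite mulrC.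
by rewrite prefix; congr (_ * _); apply: eq_bigr => k _; rewrite valK.
Qed.

(** * Growth of a single flip *)

(** For p > 0 this is p times the strict tangent bound
    log y < log (2 p) + (y / (2 p) - 1).  The form with the factor p distributed
    remains true at p = 0, where both logarithmic terms vanish and what is left
    is 0 < y / 2. *)
Lemma mul_lne_lt_tangent {R : realType} (p y : R) :
  0 <= p -> 0 <= y -> y != 2 * p ->
  (p%:E * lne y%:E < (p * ln (2 * p) + (y / 2 - p))%:E)%E.
Proof.
rewrite le_eqVlt => /predU1P[<-|p0] y0 yp.
  by rewrite mul0e lte_fin mul0r; move/eqP: yp => yp; lra.
move: y0; rewrite le_eqVlt => /predU1P[<-|y0].
  by rewrite (le0_lneNy (x := 0))// gt0_muleNy ?ltNyr.
rewrite lne_EFin// -EFinM lte_fin.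
have t0 : 0 < y / (2 * p) by rewrite divr_gt0//; lra.
have lt1 : ln (y / (2 * p)) < y / (2 * p) - 1.
  rewrite -ltr_expR lnK//.
  have := @expR_gt1Dx R (y / (2 * p) - 1); rewrite addrCA subrr addr0; apply.
  by rewrite subr_eq0; apply: contra yp => /eqP/divr1_eq ->.
rewrite ln_div ?posrE ?mulr_gt0// in lt1.
rewrite -(ltr_pM2l p0) in lt1.
have e : p * (y / (2 * p) - 1) = y / 2 - p by field; lra.
lra.
Qed.

Lemma mul_lne_diag {R : realType} (p : R) :
  0 <= p -> (p%:E * lne (2 * p)%:E = (p * ln (2 * p))%:E)%E.
Proof.
rewrite le_eqVlt => /predU1P[<-|p0]; first by rewrite mul0e mul0r.
by rewrite lne_EFin// mulr_gt0.
Qed.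

Definition growth {R : realType} (p c : R) : \bar R :=
  (p%:E * lne (1 + c)%:E + (1 - p)%:E * lne (1 - c)%:E)%E.

Lemma growth_opt_fin {R : realType} (p : R) :
  0 <= p <= 1 -> growth p (2 * p - 1) \is a fin_num.
Proof.
move=> /andP[p0 p1]; rewrite /growth.
have -> : 1 + (2 * p - 1) = 2 * p by ring.
have -> : 1 - (2 * p - 1) = 2 * (1 - p) by ring.
by rewrite !mul_lne_diag// subr_ge0.
Qed.

(** The linear terms (1 + c) / 2 - p and (1 - c) / 2 - (1 - p) of the two
    tangent bounds add up to 0. *)
Lemma growth_lt_opt {R : realType} (p c : R) :
  0 <= p <= 1 -> -1 <= c <= 1 -> c != 2 * p - 1 ->
  (growth p c < growth p (2 * p - 1))%E.
Proof.
move=> /andP[p0 p1] /andP[c0 c1] /eqP cp; rewrite /growth.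
have -> : 1 + (2 * p - 1) = 2 * p by ring.
have -> : 1 - (2 * p - 1) = 2 * (1 - p) by ring.
rewrite !mul_lne_diag ?subr_ge0//.
have hd : (p%:E * lne (1 + c)%:E < (p * ln (2 * p) + ((1 + c) / 2 - p))%:E)%E.
  by apply: mul_lne_lt_tangent; [|lra|apply/eqP; lra].
have tl : ((1 - p)%:E * lne (1 - c)%:E <
    ((1 - p) * ln (2 * (1 - p)) + ((1 - c) / 2 - (1 - p)))%:E)%E.
  by apply: mul_lne_lt_tangent; [lra|lra|apply/eqP; lra].
apply: (lt_le_trans (lteD hd tl)); rewrite -!EFinD lee_fin; lra.
Qed.

Lemma growth_le_opt {R : realType} (p c : R) :
  0 <= p <= 1 -> -1 <= c <= 1 ->
  (growth p c <= growth p (2 * p - 1))%E.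
Proof.
move=> p01 c11; have [->//|cp] := eqVneq c (2 * p - 1).
exact/ltW/growth_lt_opt.
Qed.

(** * Sums of growths *)

(** Finiteness of the G i is essential: a common infinite summand would absorb
    the strict inequality. *)
Lemma lte_sum_fin {R : realType} {I : finType} (F G : I -> \bar R) (k : I) :
  (forall i, (F i <= G i)%E) -> (forall i, G i \is a fin_num) ->
  (F k < G k)%E -> (\sum_i F i < \sum_i G i)%E.
Proof.
move=> FG Gfin FGk; rewrite (bigD1 k)//= [ltRHS](bigD1 k)//=.
apply: (@le_lt_trans _ _ (F k + \sum_(i | i != k) G i)%E).
  by apply: leeD => //; apply: lee_sum.
by rewrite lteD2rE//; apply/sum_fin_numP => i _ _; exact: Gfin.
Qed.

(** The growth is affine in p for fixed c, even if one of the two logarithms is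
    -oo, since all weights p k and 1 - p k are nonnegative. *)
Lemma sum_growth_average {R : realType} (n : nat) (p : 'I_n -> R) (c : R) :
  (1 <= n)%N -> (forall k, 0 <= p k <= 1) ->
  ((n%:R^-1)%:E * \sum_(k < n) growth (p k) c =
   growth (n%:R^-1 * \sum_(k < n) p k) c)%E.
Proof.
move=> n1 p01; have n0 : n%:R != 0 :> R by rewrite pnatr_eq0 -lt0n.
have muloo (q y : R) : 0 <= q -> (q%:E * lne y%:E < +oo)%E.
  move=> q0; have := lne_lty y; case: (lne _) => [r| |]// _.
    by rewrite -EFinM ltry.
  move: q0; rewrite le_eqVlt => /predU1P[<-|q0]; first by rewrite mul0e ltry.
  by rewrite gt0_muleNy ?ltNyr.
rewrite /growth big_split -!ge0_sume_distrl; last 2 first.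
- by move=> k _; rewrite lee_fin subr_ge0; have /andP[] := p01 k.
- by move=> k _; rewrite lee_fin; have /andP[] := p01 k.
rewrite !sumEFin muleDr//; last first.
  apply: ltpinfty_adde_def; rewrite inE; apply: muloo; apply: sumr_ge0 => k _.
    by have /andP[] := p01 k.
  by rewrite subr_ge0; have /andP[] := p01 k.
rewrite !muleA -!EFinM; congr (_ + _%:E * _)%E.
by rewrite sumrB sumr_const card_ord; field.
Qed.

(** * Expectations over the flips *)

Lemma measurable_head {d : measure_display} {T : measurableType d}
    {R : realType} {P : probability T R} (X : {RV P >-> R}) :
  measurable [set w | X w = 1].
Proof.
by rewrite -[X in measurable X]/(X @^-1` [set 1]); exact: measurable_funPTI.
Qed.

Lemma prob_headE {d : measure_display} {T : measurableType d} {R : realType}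
    {P : probability T R} {n : nat} (X : 'I_n -> {RV P >-> R}) (k : 'I_n) :
  P [set w | X k w = 1] = (prob_head X k)%:E.
Proof.
by rewrite /prob_head fineK//; apply: fin_num_measure; exact: measurable_head.
Qed.

Lemma prob_head_itv {d : measure_display} {T : measurableType d}
    {R : realType} {P : probability T R} {n : nat}
    (X : 'I_n -> {RV P >-> R}) (k : 'I_n) : 0 <= prob_head X k <= 1.
Proof.
rewrite -!lee_fin -prob_headE measure_ge0 probability_le1//.
exact: measurable_head.
Qed.

Lemma expectation_num_heads {d : measure_display} {T : measurableType d}
    {R : realType} {P : probability T R} {n : nat}
    (X : 'I_n -> {RV P >-> R}) :
  ('E_P[num_heads X] = (\sum_(k < n) prob_head X k)%:E)%E.
Proof.
pose A k := [set w | X k w = 1].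
have mA k : measurable (A k) by exact: measurable_head.
rewrite unlock.
transitivity (\int[P]_w \sum_(k < n) (\1_(A k) w)%:E)%E.
  apply: eq_integral => w _; rewrite sumEFin; congr _%:E.
  rewrite /num_heads -sum1_card natr_sum big_mkcond /=.
  apply: eq_bigr => k _; rewrite indicE unfold_in /=.
  by case: eqP => Xk; [rewrite mem_set|rewrite memNset].
rewrite ge0_integral_sum//; last first.
  by move=> k; apply/measurable_EFinP; exact: measurable_indic.
rewrite -sumEFin; apply: eq_bigr => k _.
by rewrite integral_indic// setIT; exact: prob_headE.
Qed.

(** The hypothesis on K makes every factor 1 + K_k X_k nonnegative, so the
    logarithm of their product splits, with log 0 = -oo absorbing. *)
Lemma ELG_growth {d : measure_display} {T : measurableType d}
    {R : realType} {P : probability T R} {n : nat}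
    (X : 'I_n -> {RV P >-> R})
    (X_pm1 : forall (k : 'I_n) (w : T), X k w = 1 \/ X k w = -1)
    (V0 : R) (V0_gt0 : 0 < V0) (K : 'cV[R]_n) :
  bet_vectors R n K ->
  ELG X V0 K =
    ((n%:R^-1)%:E * \sum_(k < n) growth (prob_head X k) (K k 0%R))%E.
Proof.
move=> K11; rewrite /ELG; congr (_ * _)%E.
pose A k := [set w | X k w = 1].
have mA k : measurable (A k) by exact: measurable_head.
pose f k w := (if w \in A k then lne (1 + K k 0)%:E else lne (1 - K k 0)%:E).
transitivity (\int[P]_w \sum_(k < n) f k w)%E.
  apply: eq_integral => w _.
  rewrite account_prod mulrC mulKf ?gt_eqF// lne_prod; last first.
    by move=> k; have /andP[] := K11 k; case: (X_pm1 k w) => ->; lra.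
  apply: eq_bigr => k _; rewrite /f; case: (X_pm1 k w) => Xk.
    by rewrite mem_set// Xk mulr1.
  rewrite memNset/A/= Xk ?mulrN1//.
  by move=> ?; lra.
rewrite (integral_sum_ubounded P _ (c := 2)); last 2 first.
- by move=> k; exact: measurable_fun_two_valued.
- move=> k w; have /andP[K0 K1] := K11 k.
  (* The bound 2 comes from log y < y and 1 + K, 1 - K <= 2. *)
  have lne_le2 (y : R) : y <= 2 -> (lne y%:E <= 2%:E)%E.
    by move=> y2; apply: (le_trans (ltW (lne_sublinear _))).
  by rewrite /f; case: ifP => _; apply: lne_le2; lra.
apply: eq_bigr => k _.
by rewrite /f integral_two_valued ?lne_lty// /A prob_headE.
Qed.

Theorem mainTheorem3 (R : realType) (d : measure_display)
    (T : measurableType d) (P : probability T R) (n : nat) (n_ge1 : (1 <= n)%N)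
    (X : 'I_n -> {RV P >-> R})
    (X_pm1 : forall (k : 'I_n) (w : T), X k w = 1 \/ X k w = -1)
    (V0 : R) (V0_gt0 : 0 < V0) :
  (forall K : 'cV[R]_n, bet_vectors R n K ->
     ELG X V0 K =
       ((n%:R^-1)%:E *
         \sum_(k < n) ((prob_head X k)%:E * lne (1 + K k 0)%:E +
                       (1 - prob_head X k)%:E * lne (1 - K k 0)%:E))%E)
  /\
  (exists Kopt : 'cV[R]_n,
     [/\ forall K : 'cV[R]_n,
           is_maximizer (bet_vectors R n) (ELG X V0) K <-> K = Kopt,
         forall k : 'I_n, Kopt k 0 = 2 * prob_head X k - 1 &
         exists Kn : R,
           [/\ forall c : R,
                 is_maximizer [set c : R | -1 <= c <= 1]
                   (fun c => ELG X V0 (const_mx c)) c <-> c = Kn,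
               Kn = 2 * (fine ('E_P[num_heads X])%E / n%:R) - 1 &
               Kn = n%:R^-1 * \sum_(k < n) Kopt k 0]]).
Proof.
have n0 : n%:R != 0 :> R by rewrite pnatr_eq0 -lt0n.
have ninv0 : (0 < (n%:R^-1)%:E :> \bar R)%E by rewrite lte_fin invr_gt0 ltr0n.
have elg := ELG_growth X X_pm1 V0 V0_gt0.
have p01 := prob_head_itv X.
have opt11 (p : R) : 0 <= p <= 1 -> -1 <= 2 * p - 1 <= 1.
  by move=> /andP[? ?]; lra.
split; first exact: elg.
pose Kopt : 'cV[R]_n := \col_k (2 * prob_head X k - 1).
have KoptE k : Kopt k 0 = 2 * prob_head X k - 1 by rewrite mxE.
have Kopt11 : bet_vectors R n Kopt by move=> k; rewrite KoptE opt11.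
(* Averaging the one-flip formula reduces the constant bet to a single flip
   whose probability of heads is q. *)
pose q := n%:R^-1 * \sum_(k < n) prob_head X k.
have q01 : 0 <= q <= 1.
  rewrite /q mulrC ler_pdivlMr ?ltr0n// ler_pdivrMr ?ltr0n// mul0r mul1r.
  rewrite sumr_ge0/=; last by move=> k _; have /andP[] := p01 k.
  rewrite -[X in _ <= X%:R](card_ord n) -sumr_const.
  by apply: ler_sum => k _; have /andP[] := p01 k.
have elg_const c : -1 <= c <= 1 -> ELG X V0 (const_mx c) = growth q c.
  move=> c11; rewrite elg; last by move=> k; rewrite mxE.
  rewrite -sum_growth_average//; congr (_ * _)%E.
  by apply: eq_bigr => k _; rewrite mxE.
exists Kopt; split => //.
  move=> K; split=> [[K11 Kmax]|->].
    apply/eqP/negPn/negP => /eqP neq.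
    have [k Kk] : exists k, K k 0 != Kopt k 0.
      apply: contrapT => /forallNP same; apply: neq.
      by apply/colP => k; apply/eqP/negPn/negP/same.
    have := Kmax _ Kopt11; rewrite leNgt !elg// lte_pmul2l// => /negP; apply.
    apply: (lte_sum_fin _ _ k) => [i|i|].
    - by rewrite KoptE growth_le_opt// K11.
    - by rewrite KoptE growth_opt_fin.
    - by rewrite KoptE growth_lt_opt -?KoptE// K11.
  split=> // B B11; rewrite !elg// lee_pmul2l//.
  by apply: lee_sum => k _; rewrite KoptE growth_le_opt// B11.
exists (2 * q - 1); split.
- move=> c; split=> [[c11 cmax]|->].
    apply/eqP/negPn/negP => neq.
    have := cmax _ (opt11 _ q01); rewrite !elg_const ?opt11// leNgt => /negP.
    by apply; exact: growth_lt_opt.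
  split=> [|b b11]; first exact: opt11.
  by rewrite !elg_const ?opt11// growth_le_opt.
- by rewrite expectation_num_heads /q [_^-1 * _]mulrC.
- under eq_bigr do rewrite KoptE.
  rewrite sumrB -mulr_sumr sumr_const card_ord /q.
  by field.
Qed.
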